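(* Let $m\ge 1$ and $n\ge 1$ be integers and let $s$ be a real number with $0<s<m+1$. For the facets of $SMET^{m,s}_n$ the following hold. (i) For every $(m+2)$-subset $A\subset V_n$ and every $i\in A$, the non-negativity facet $NN_{A\setminus\{i\}}$ is not adjacent to the $(m,s)$-simplex facet $ST_{A;i}$ in the cone $SMET^{m,s}_n$. (ii) Two distinct $m$-simplex facets (that is, $(m,s)$-simplex facets in the case $s=1$) are not adjacent if they have the same support, i.e. if they are $ST_{T;i}$ and $ST_{T;j}$ with $T$ an $(m+2)$-subset of $V_n$ and $i\neq j$ in $T$. (iii) If $m-1\le s<m$, then the non-negativity facets $NN_A$ and $NN_B$, where $A,B$ are $(m+1)$-subsets of $V_n$, are not adjacent if $|A\cap B|=m$.
   Context: Let $V_n=\{1,\dots,n\}$ and let $\binom{V_n}{m+1}$ be the set of $(m+1)$-subsets of $V_n$. For $d\in\mathbb{R}^{\binom{V_n}{m+1}}$, an $(m+2)$-subset $T\subset V_n$ and $i\in T$, the $(m,s)$-simplex inequality for $(T,i)$ is $$s\, d(T\setminus\{i\})\le \sum_{k\in T\setminus\{i\}} d(T\setminus\{k\});$$ for $s=1$ it is called the $m$-simplex inequality. For an $(m+1)$-subset $A\subset V_n$ the non-negativity inequality is $d(A)\ge 0$. The cone $SMET^{m,s}_n\subset\mathbb{R}^{\binom{V_n}{m+1}}$ (the cone of $(m,s)$-super-metrics; for $s=1$ the cone of $m$-hemi-metrics) is the set of all $d$ satisfying all $(m,s)$-simplex inequalities and all non-negativity inequalities on $V_n$. $ST_{T;i}$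 denotes the face of $SMET^{m,s}_n$ on which the $(m,s)$-simplex inequality for $(T,i)$ holds with equality, and $T$ is called its support; $NN_A$ denotes the face on which $d(A)=0$. A facet of a polyhedral cone $C$ is a face of dimension $\dim(C)-1$; the faces above are considered whenever they are facets. Two facets of $C$ are adjacent if their intersection has dimension $\dim(C)-2$.
   Formalization: Part (ii) excludes the case m = 1, n = 3, where the claim is false: the cone of metrics on three points is simplicial of dimension 3, and any two of its triangle facets meet in an extreme ray, hence are adjacent. *)

(* Defs.v *)
From HB Require Import structures.
From mathcomp Require Import all_boot all_order all_algebra.
From mathcomp Require Import boolp classical_sets reals.

Set Implicit Arguments.
Unset Strict Implicit.
Unset Printing Implicit Defensive.

Import Order.TTheory GRing.Theory Num.Theory.
Local Open Scope ring_scope.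
Local Open Scope classical_set_scope.

Section Dimension.
Variables (R : realType) (E : vectType R).
Implicit Types (C F G : set E) (V W : {vspace E}).

(* Linear hull of an arbitrary set; [lspanP] below shows that it exists, so the
   default value 0 is never used. *)
Definition is_lspan (S : set E) V :=
  forall W, (V <= W)%VS <-> (forall x, S x -> x \in W).

Definition lspan (S : set E) : {vspace E} := xget 0%VS [set V | is_lspan S V].

Lemma lspanP (S : set E) : is_lspan S (lspan S).
Proof.
rewrite /lspan; apply: (xgetPex 0%VS).
pose P k := `[< exists V, \dim V = k /\
                  forall W, (forall x, S x -> x \in W) -> (V <= W)%VS >].
have exP : exists k, P k.
  by exists 0%N; apply/asboolP; exists 0%VS; split; [exact: dimv0 | move=> W _; exact: sub0v].
have leP k : P k -> (k <= \dim {:E})%N.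
  by move=> /asboolP[V [<- _]]; apply/dimvS/subvf.
case: (ex_maxnP exP leP) => k /asboolP[V [dV minV]] maxk.
exists V => W; split; last exact: minV.
move=> VW x Sx; apply: (subvP VW).
have /maxk : P (\dim (V + <[x]>)).
  apply/asboolP; exists (V + <[x]>)%VS; split=> // U SU.
  by rewrite subv_add minV//= -memvE; apply: SU.
rewrite -dV => le_dim; have /eqP eqV : (V == V + <[x]>)%VS.
  by rewrite eqEdim addvSl.
by rewrite eqV memvE addvSr.
Qed.

(* All the sets whose dimension is taken below contain 0, so that their linear
   and affine hulls coincide. *)
Definition set_dim (S : set E) : nat := \dim (lspan S).

Definition is_face C F := exists l : {linear E -> R^o},
  (forall x, C x -> 0 <= l x) /\ F = [set x | C x /\ l x = 0].

Definition is_facet C F := is_face C F /\ (set_dim F).+1 = set_dim C.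

(* To be used for facets [F] and [G] of [C]. *)
Definition adjacent C F G := (set_dim (F `&` G)).+2 = set_dim C.

End Dimension.

Section SuperMetrics.
Variables (R : realType) (n m : nat) (s : R).

(* The point i : 'I_n stands for the element i + 1 of {1, ..., n}. *)
Definition subsets := {A : {set 'I_n} | #|A| == m.+1}.

Definition dvec := {ffun subsets -> R^o}.

(* The coordinate d(A); the value 0 for #|A| <> m + 1 is a placeholder which is
   never used below. *)
Definition dval (d : dvec) (A : {set 'I_n}) : R :=
  if insub A is Some a then d a else 0.

Definition SMET : set dvec := [set d |
  (forall (T : {set 'I_n}) (i : 'I_n), #|T| = m.+2 -> i \in T ->
     s * dval d (T :\ i) <= \sum_(k in T :\ i) dval d (T :\ k)) /\
  (forall A : {set 'I_n}, #|A| = m.+1 -> 0 <= dval d A)].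

Definition ST (T : {set 'I_n}) (i : 'I_n) : set dvec := [set d |
  SMET d /\ s * dval d (T :\ i) = \sum_(k in T :\ i) dval d (T :\ k)].

Definition NN (A : {set 'I_n}) : set dvec := [set d |
  SMET d /\ dval d A = 0].

End SuperMetrics.

Arguments SMET {R} n m s.
Arguments ST {R n} m s T i.
Arguments NN {R n} m s A.

(* Main.v *)
Require Import Defs.
From HB Require Import structures.
From mathcomp Require Import all_boot all_order all_algebra.
From mathcomp Require Import boolp classical_sets reals.
From mathcomp Require Import zify ring lra.
From mathcomp Require Import fintype finset.

Set Implicit Arguments.
Unset Strict Implicit.
Unset Printing Implicit Defensive.

Import Order.TTheory GRing.Theory Num.Theory.
Local Open Scope ring_scope.

(** The cone [SMET n m s] is full-dimensional because [s < m + 1] makes the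
    all-ones vector an interior point ([set_dim_SMET]).  Two facets are
    therefore adjacent only if their intersection has codimension exactly 2 in
    the whole space, and each part is proved by exhibiting at least three
    independent linear equations that hold on the intersection.

    These equations always have the form [d(P) = d(Q P)], for [P] in a family
    [J] of (m+1)-sets, where [Q P] is outside [J]; an equation [d(P) = 0] is the
    case of a set [Q P] of another cardinality, where [dval] is 0.  They express
    the coordinates in [J] through the others, so the intersection has
    codimension at least [#|J|] ([set_dim_elim], [not_adjacent_elim]).

    Fix a simplex [T] with m+2 points, and write [x_k = d(T \ k)] and
    [S = \sum_(k in T) x_k]; the simplex inequality for [(T, k)] reads
    [(s + 1) x_k <= S].
    - (i) If [x_i = 0] and the inequality for [i] is tight, then [S = 0], so
      all m+2 coordinates [x_k] vanish.
    - (ii) For [s = 1], tightness for [i] and [j] means [2 x_i = S = 2 x_j], so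
      [x_i = x_j] and the other m coordinates vanish.  This gives m+1
      equations, enough if [m > 1].  For [m = 1], the vanishing [d{i,j} = 0] of
      a distance makes [i] and [j] equidistant from every other point, which
      gives n-1 equations, enough if [n > 3].
    - (iii) If [x_a = x_b = 0], summing the inequalities over the other m
      points gives [(s + 1) S <= m S]; as [m <= s + 1], equality holds in each
      of them, so these m coordinates are equal.  This gives m+1 equations,
      enough if [m > 1].  For [m = 1], the only remaining coordinate satisfies
      [(s + 1) x = x], hence vanishes. *)

(** * Dimension and coordinates *)

Section Restriction.
Variables (R : fieldType) (I : finType) (J : {set I}).

Definition restrictC (d : {ffun I -> R^o}) : {ffun {i | i \notin J} -> R^o} :=
  [ffun i => d (val i)].

Fact restrictC_is_linear : linear restrictC.
Proof. by move=> a d e; apply/ffunP => i; rewrite !ffunE. Qed.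

HB.instance Definition _ :=
  GRing.isLinear.Build R _ _ _ restrictC restrictC_is_linear.

(** The restriction to the coordinates outside [J] is injective on such a [W]. *)
Lemma dim_determined_off (W : {vspace {ffun I -> R^o}}) :
  (forall d, d \in W -> (forall i, i \notin J -> d i = 0) -> d = 0) ->
  (\dim W + #|J| <= #|I|)%N.
Proof.
move=> Winj; have /limg_dim_eq <- : (W :&: lker (linfun restrictC) = 0)%VS.
  apply/eqP; rewrite -subv0; apply/subvP => d.
  rewrite memv_cap memv_ker lfunE => /andP[Wd /eqP/ffunP d0].
  rewrite memv0; apply/eqP/Winj => // i iJ.
  by have := d0 (exist _ i iJ); rewrite !ffunE.
have -> : #|I| = (#|{: {i | i \notin J}}| + #|J|)%N.
  by rewrite card_sig -(cardC [in J]) addnC.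
by rewrite leq_add2r (leq_trans (dimvS (subvf _)))// dimvf /dim /= muln1.
Qed.

End Restriction.

Section Coordinates.
Variables (R : realType) (n m : nat).
Implicit Types (d : dvec R n m) (A P Q : {set 'I_n}).

Lemma dval_val d (a : subsets n m) : dval d (val a) = d a.
Proof. by rewrite /dval valK. Qed.

Lemma dval_insub d A (cA : #|A| == m.+1) : dval d A = d (exist _ A cA).
Proof. by rewrite -dval_val. Qed.

Lemma dval_out d A : #|A| != m.+1 -> dval d A = 0.
Proof. by move=> cA; rewrite /dval insubF//; apply/negbTE. Qed.

Definition dvalB P Q d : R^o := dval d P - dval d Q.

Fact dvalB_is_linear P Q : linear (dvalB P Q).
Proof.
have dvalP A : linear (fun d => dval d A : R^o).
  move=> a d e; have [cA|cA] := boolP (#|A| == m.+1).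
    by rewrite !(dval_insub _ cA) !ffunE.
  by rewrite !dval_out// scaler0 addr0.
move=> a d e; rewrite /dvalB !dvalP /GRing.scale /=; ring.
Qed.

HB.instance Definition _ P Q :=
  GRing.isLinear.Build R _ _ _ (dvalB P Q) (dvalB_is_linear P Q).

(** Eliminating the coordinates in [J] bounds the dimension: the equations pass
    from [S] to its linear hull, where they force a vector that vanishes
    outside [J] to be 0.  Taking [Q P] of the wrong cardinality, such as [set0],
    encodes the equation [d(P) = 0]. *)
Lemma set_dim_elim (S : set (dvec R n m)) (J : {set {set 'I_n}})
    (Q : {set 'I_n} -> {set 'I_n}) :
  (forall P, P \in J -> #|P| = m.+1 /\ Q P \notin J) ->
  (forall d, S d -> forall P, P \in J -> dval d P = dval d (Q P)) ->
  (set_dim S + #|J| <= #|{: subsets n m}|)%N.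
Proof.
move=> JQ SQ.
have -> : #|J| = #|[set a : subsets n m | val a \in J]|.
  rewrite -[RHS](card_imset _ val_inj); apply: eq_card => P.
  apply/idP/imsetP => [PJ|[a + ->]]; last by rewrite inE.
  have [/eqP cP _] := JQ P PJ.
  by exists (exist _ P cP); rewrite ?inE.
apply: dim_determined_off => d dS d0.
have dval0 P : P \notin J -> dval d P = 0.
  move=> PJ; have [cP|cP] := boolP (#|P| == m.+1); last exact: dval_out.
  by rewrite (dval_insub _ cP) d0 ?inE.
apply/ffunP => a; rewrite -dval_val ffunE.
have [aJ|aJ] := boolP (val a \in J); last exact: dval0.
have [_ /dval0 <-] := JQ _ aJ.
have : (lspan S <= lker (linfun (dvalB (val a) (Q (val a)))))%VS.
  apply/(@lspanP R _ S) => x Sx; rewrite memv_ker lfunE /= /dvalB.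
  by rewrite subr_eq0; apply/eqP/SQ.
by move/subvP/(_ _ dS); rewrite memv_ker lfunE /= subr_eq0 => /eqP.
Qed.

Lemma dval_set0 d : dval d set0 = 0.
Proof. by rewrite dval_out// cards0. Qed.

End Coordinates.

(** * Facets of a simplex *)

Section SimplexFacets.
Variables (n m : nat).
Implicit Types (T D P : {set 'I_n}) (i j : 'I_n).

Lemma card_setD1S T k p : #|T| = p.+1 -> k \in T -> #|T :\ k| = p.
Proof. by move=> cT kT; move: (cardsD1 k T); rewrite kT cT => -[]. Qed.

Lemma setD1_inj T i j : i \in T -> T :\ i = T :\ j -> i = j.
Proof.
move=> iT /setP/(_ i); rewrite !inE iT eqxx/=.
by move=> /esym/negbT/nandP[/negPn/eqP|].
Qed.

Lemma card_facets T (D : {set 'I_n}) :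
  D \subset T -> #|[set T :\ k | k in D]| = #|D|.
Proof.
move=> DT; rewrite card_in_imset// => i j /(subsetP DT) iT _.
exact: setD1_inj.
Qed.

Lemma facets_card T (D : {set 'I_n}) P : #|T| = m.+2 -> D \subset T ->
  P \in [set T :\ k | k in D] -> #|P| = m.+1.
Proof.
by move=> cT DT /imsetP[k /(subsetP DT) kT ->]; apply: card_setD1S.
Qed.

Lemma set0_facets T D : (1 < #|T|)%N ->
  set0 \notin [set T :\ k | k in D].
Proof.
move=> cT; apply/imsetP => -[k _ /(congr1 (fun A : {set 'I_n} => #|A|))].
move: (cardsD1 k T) cT; rewrite cards0; lia.
Qed.

End SimplexFacets.

(** * Consequences of the simplex inequalities *)

Section SuperMetricInequalities.
Variables (R : realType) (n m : nat) (s : R).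
Implicit Types (d : dvec R n m) (A T : {set 'I_n}) (i k : 'I_n).

Lemma SMET_ge0 d A : SMET n m s d -> 0 <= dval d A.
Proof.
move=> [_ d_ge0]; have [/eqP/d_ge0//|cA] := boolP (#|A| == m.+1).
by rewrite dval_out.
Qed.

(** Adding [d(T \ i)] to both sides makes the right-hand side independent of
    [i], so that the inequalities for different [i] can be compared. *)
Lemma SMET_simplex d T i : SMET n m s d -> #|T| = m.+2 -> i \in T ->
  (s + 1) * dval d (T :\ i) <= \sum_(k in T) dval d (T :\ k).
Proof.
move=> [simp _] cT iT; rewrite (big_setD1 i)//= addrC mulrDl mul1r lerD2r.
exact: simp.
Qed.

Lemma ST_simplex d T i : ST m s T i d -> i \in T ->
  (s + 1) * dval d (T :\ i) = \sum_(k in T) dval d (T :\ k).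
Proof. by move=> [_ eq_s] iT; rewrite (big_setD1 i)//= -eq_s; ring. Qed.

(** The simplex inequalities for the m points [k] of [T] other than [a] and [b]
    have nonnegative gaps [S - (s + 1) d(T \ k)].  The gaps sum to
    [(m - (s + 1)) S <= 0], so they all vanish. *)
Lemma NN_NN_facets_eq d T a b : m%:R - 1 <= s -> #|T| = m.+2 ->
  a \in T -> b \in T -> a != b ->
  NN m s (T :\ a) d -> NN m s (T :\ b) d ->
  forall k, k \in T :\ a :\ b ->
    (s + 1) * dval d (T :\ k) = \sum_(l in T :\ a :\ b) dval d (T :\ l).
Proof.
move=> s_ge cT aT bT ab [Sd da0] [_ db0] k kT.
have bTa : b \in T :\ a by rewrite !inE eq_sym ab.
set S := \sum_(l in _) _.
have sumT : \sum_(l in T) dval d (T :\ l) = S.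
  by rewrite (big_setD1 a)//= (big_setD1 b)//= da0 db0 !add0r.
have gap_ge0 l : l \in T :\ a :\ b -> 0 <= S - (s + 1) * dval d (T :\ l).
  by rewrite !inE subr_ge0 -sumT => /and3P[_ _]; apply: SMET_simplex.
suff /psumr_eq0P/(_ _ kT)/eqP : \sum_(l in T :\ a :\ b)
    (S - (s + 1) * dval d (T :\ l)) = 0.
  by rewrite subr_eq0 => /(_ gap_ge0)/eqP.
apply/eqP; rewrite eq_le sumr_ge0 ?andbT//.
rewrite sumrB sumr_const -mulr_sumr -/S.
rewrite (card_setD1S (card_setD1S cT aT) bTa) -[S *+ m]mulr_natl -mulrBl.
rewrite mulr_le0_ge0 ?sumr_ge0// => [|l _]; last exact: SMET_ge0.
lra.
Qed.

End SuperMetricInequalities.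

(** * Non-adjacency by elimination; parts (i) and (iii) *)

Section FullDimension.
Variables (R : realType) (n m : nat) (s : R).
Hypotheses (s_gt0 : 0 < s) (s_lt : s < m.+1%:R).
Implicit Types (d : dvec R n m) (A T : {set 'I_n}) (i k : 'I_n).

(** The value [m.+1 / s] at [a] makes the simplex inequalities with [d(a)] on the
    left-hand side tight when all other coordinates are 1; it exceeds 1 because
    [s < m + 1]. *)
Lemma SMET_bump (a : subsets n m) :
  SMET n m s [ffun b => 1 + (m.+1%:R / s - 1) *+ (b == a)].
Proof.
set d := finfun _.
have t_ge0 : 0 <= m.+1%:R / s - 1.
  by rewrite subr_ge0 ler_pdivlMr// mul1r ltW.
have d_ge1 A : #|A| = m.+1 -> 1 <= dval d A.
  by move/eqP => cA; rewrite (dval_insub _ cA) ffunE lerDl mulrn_wge0.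
split=> [T i cT iT|A cA]; last exact: le_trans (d_ge1 _ cA).
apply: (@le_trans _ _ m.+1%:R).
  have /eqP cA := card_setD1S cT iT.
  rewrite (dval_insub _ cA) ffunE mulrC -ler_pdivlMr//.
  case: eqP => _; rewrite ?mulr1n ?mulr0n ?addr0; first by rewrite addrC subrK.
  by rewrite -subr_ge0.
rewrite -(card_setD1S cT iT) -sum1_card natr_sum ler_sum// => k.
by rewrite !inE => /andP[_ kT]; apply: d_ge1; apply: card_setD1S.
Qed.

Lemma SMET_ones : SMET n m s [ffun=> 1].
Proof.
have dE A : #|A| = m.+1 -> dval ([ffun=> 1] : dvec R n m) A = 1.
  by move/eqP => cA; rewrite (dval_insub _ cA) ffunE.
split=> [T i cT iT|A /dE->//].
rewrite (dE _ (card_setD1S cT iT)) mulr1.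
rewrite (eq_bigr (fun=> 1)) => [|k]; last first.
  by rewrite !inE => /andP[_ kT]; apply/dE/card_setD1S.
by rewrite sumr_const (card_setD1S cT iT) ltW.
Qed.

(** The differences of the bumped vectors and the all-ones vector are nonzero
    multiples of the basis vectors. *)
Lemma set_dim_SMET : set_dim (SMET n m s) = #|{: subsets n m}|.
Proof.
have SMETl d : SMET n m s d -> d \in lspan (SMET n m s).
  by apply: (lspanP (SMET n m s) _).1; apply: subvv.
suff -> : set_dim (SMET n m s) = \dim {: dvec R n m}.
  by rewrite dimvf /dim /= muln1.
congr (\dim _); apply/eqP; rewrite eqEsubv subvf; apply/subvP => d _.
pose t := m.+1%:R / s - 1.
have t_neq0 : t != 0 by rewrite gt_eqF// subr_gt0 ltr_pdivlMr// mul1r.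
have -> : d = \sum_(a : subsets n m) (d a / t) *:
    (([ffun b => 1 + t *+ (b == a)] : dvec R n m) - [ffun=> 1]).
  apply/ffunP => b; rewrite sum_ffunE (bigD1 b)//= big1 => [|a /negPf ab].
    by rewrite !ffunE eqxx addrAC subrr add0r addr0 /GRing.scale /= mulfVK.
  by rewrite !ffunE eq_sym ab addr0 subrr scaler0.
apply: memv_suml => a _; apply/memvZ/memvB; apply: SMETl.
  exact: SMET_bump.
exact: SMET_ones.
Qed.

Lemma not_adjacent_elim (F G : set (dvec R n m)) (J : {set {set 'I_n}})
    (Q : {set 'I_n} -> {set 'I_n}) :
  (2 < #|J|)%N ->
  (forall P, P \in J -> #|P| = m.+1 /\ Q P \notin J) ->
  (forall d, F d -> G d -> forall P, P \in J -> dval d P = dval d (Q P)) ->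
  ~ adjacent (SMET n m s) F G.
Proof.
move=> J3 JQ FGQ; rewrite /adjacent set_dim_SMET => adj.
have : (set_dim (F `&` G)%classic + #|J| <= #|{: subsets n m}|)%N.
  by apply: (set_dim_elim JQ) => d [/FGQ].
by rewrite -adj -addn2 leq_add2l leqNgt J3.
Qed.

(** The sum of the nonnegative coordinates [d(T \ k)], [k \in T], is
    [(s + 1) d(T \ i) = 0]. *)
Lemma not_adjacent_NN_ST T i : #|T| = m.+2 -> i \in T -> (1 <= m)%N ->
  ~ adjacent (SMET n m s) (NN m s (T :\ i)) (ST m s T i).
Proof.
move=> cT iT m_gt0.
apply: (@not_adjacent_elim _ _ [set T :\ k | k in T] (fun=> set0)).
- by rewrite card_facets// cT.
- by move=> P PJ; rewrite (facets_card cT (subxx _) PJ) set0_facets ?cT.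
move=> d [Sd di0] dST _ /imsetP[k kT ->]; rewrite dval_set0.
apply: (psumr_eq0P (P := [in T]) (F := fun k => dval d (T :\ k))) => // [l _|].
  exact: SMET_ge0 Sd.
by rewrite -(ST_simplex dST iT) di0 mulr0.
Qed.

(** For [m > 1], the coordinates [d(T \ a)] and [d(T \ b)] vanish and all others
    of [T] equal a chosen one [d(T \ l)], so every [d(T \ k)] with [k != l] is
    eliminated.  For [m = 1], this leaves two equations only, and the third is
    [d(T \ l) = 0]. *)
Lemma not_adjacent_NN_NN T a b : (1 <= m)%N -> m%:R - 1 <= s -> #|T| = m.+2 ->
  a \in T -> b \in T -> a != b ->
  ~ adjacent (SMET n m s) (NN m s (T :\ a)) (NN m s (T :\ b)).
Proof.
move=> m_gt0 s_ge cT aT bT ab.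
have bTa : b \in T :\ a by rewrite !inE eq_sym ab.
have cU := card_setD1S (card_setD1S cT aT) bTa.
have eqU := NN_NN_facets_eq s_ge cT aT bT ab.
have cases k : k \in T -> [\/ k = a, k = b | k \in T :\ a :\ b].
  move=> kT; have [->|ka] := eqVneq k a; first by constructor 1.
  have [->|kb] := eqVneq k b; first by constructor 2.
  by constructor 3; rewrite !inE kb ka.
have [l lU] : exists l, l \in T :\ a :\ b.
  by apply/set0Pn; rewrite -card_gt0 cU.
have lT : l \in T by move: lU; rewrite !inE => /and3P[].
have [m1|m_gt1] : m = 1%N \/ (1 < m)%N by lia.
  apply: (@not_adjacent_elim _ _ [set T :\ k | k in T] (fun=> set0)).
  - by rewrite card_facets// cT.
  - by move=> P PJ; rewrite (facets_card cT (subxx _) PJ) set0_facets ?cT.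
  move=> d da db _ /imsetP[k kT ->]; rewrite dval_set0.
  case/cases: kT => [->|->|kU]; [by case: da | by case: db|].
  have /eqP/cards1P[x Ux] : #|T :\ a :\ b| = 1%N by rewrite cU.
  have := eqU d da db k kU; move: kU; rewrite Ux big_set1 inE => /eqP -> eqx.
  have /eqP : s * dval d (T :\ x) = 0.
    by apply: (addIr (dval d (T :\ x))); rewrite add0r -[RHS]eqx; ring.
  by rewrite mulf_eq0 (gt_eqF s_gt0) => /eqP.
pose Q P := if P \in [set T :\ a; T :\ b] then set0 else T :\ l.
have sub : T :\ l \subset T by exact: subsetDl.
apply: (@not_adjacent_elim _ _ [set T :\ k | k in T :\ l] Q).
- by rewrite card_facets// (card_setD1S cT lT).
- move=> P PJ; rewrite (facets_card cT sub PJ); split=> //.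
  rewrite /Q; case: ifP => _; first by rewrite set0_facets ?cT.
  apply/imsetP => -[k /[swap] /(setD1_inj lT) <-].
  by rewrite !inE eqxx.
move=> d da db _ /imsetP[k /(subsetP sub) kT ->].
rewrite /Q; case: ifPn => [|kab].
  by rewrite dval_set0 !inE => /orP[] /eqP ->; [case: da | case: db].
case/cases: kT => [E|E|kU]; [by rewrite E !inE eqxx in kab
  | by rewrite E !inE eqxx orbT in kab |].
have s1 : s + 1 != 0 by rewrite gt_eqF// addr_gt0.
by apply: (mulfI s1); rewrite !(eqU d).
Qed.

End FullDimension.

(** * Hemi-metrics; part (ii) *)

Section Hemimetrics.
Variables (R : realType) (n : nat).
Implicit Types (T : {set 'I_n}) (i j l : 'I_n).

(** Both tight inequalities say [2 d(T \ i) = 2 d(T \ j) = S]; what remains of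
    [S] after removing these two terms is a sum of nonnegative terms equal
    to 0. *)
Lemma ST_ST_facets (m : nat) (d : dvec R n m) T i j : #|T| = m.+2 ->
  i \in T -> j \in T -> i != j ->
  ST m 1 T i d -> ST m 1 T j d ->
  dval d (T :\ i) = dval d (T :\ j) /\
  forall k, k \in T :\ i :\ j -> dval d (T :\ k) = 0.
Proof.
move=> cT iT jT ij di dj; have [Sd _] := di.
have jTi : j \in T :\ i by rewrite !inE eq_sym ij.
have := ST_simplex dj jT; have := ST_simplex di iT.
rewrite (big_setD1 i)//= (big_setD1 j)//= => ei ej.
split; first lra.
apply: psumr_eq0P => [k _|]; first exact: SMET_ge0 Sd.
lra.
Qed.

(** All [d(T \ k)] with [k != i] are eliminated: [d(T \ j)] equals [d(T \ i)],
    and the others vanish. *)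
Lemma not_adjacent_ST_ST (m : nat) T i j : (1 < m)%N -> #|T| = m.+2 ->
  i \in T -> j \in T -> i != j ->
  ~ adjacent (SMET n m (1 : R)) (ST m 1 T i) (ST m 1 T j).
Proof.
move=> m_gt1 cT iT jT ij.
pose Q P := if P == T :\ j then T :\ i else set0.
have sub : T :\ i \subset T by exact: subsetDl.
apply: (@not_adjacent_elim _ _ _ _ ltr01 _ _ _ [set T :\ k | k in T :\ i] Q).
- by rewrite ltr1n ltnS; lia.
- by rewrite card_facets// (card_setD1S cT iT).
- move=> P PJ; rewrite (facets_card cT sub PJ); split=> //.
  rewrite /Q; case: ifP => _; last by rewrite set0_facets ?cT.
  apply/imsetP => -[k /[swap] /(setD1_inj iT) <-].
  by rewrite !inE eqxx.
move=> d di dj _ /imsetP[k kTi ->].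
have [eij d0] := ST_ST_facets cT iT jT ij di dj.
rewrite /Q; case: eqP => [-> //|Tkj].
rewrite dval_set0 d0// in_setD1 kTi andbT.
by apply/eqP => kj; apply: Tkj; rewrite kj.
Qed.

(** Points at distance 0 are equidistant from any third one; here the points at
    distance 0 are [i] and [j], and [T \ i] is the pair [{j, l}]. *)
Lemma semimetric_eq (d : dvec R n 1) T i j l : SMET n 1 1 d -> #|T| = 3 ->
  i \in T -> j \in T -> l \in T -> i != j -> l != i -> l != j ->
  dval d (T :\ l) = 0 -> dval d (T :\ i) = dval d (T :\ j).
Proof.
move=> Sd cT iT jT lT ij li lj dl0.
have jTi : j \in T :\ i by rewrite !inE eq_sym ij.
have lTij : l \in T :\ i :\ j by rewrite !inE lj li.
have /eqP/cards1P[x Ux] : #|T :\ i :\ j| = 1%N.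
  exact: card_setD1S (card_setD1S cT iT) jTi.
have := SMET_simplex Sd cT iT; have := SMET_simplex Sd cT jT.
rewrite (big_setD1 i)//= (big_setD1 j)//=.
move: lTij; rewrite Ux big_set1 inE => /eqP <-; rewrite dl0.
lra.
Qed.

(** For [m = 1] the triangle [T] alone gives two equations, so the other
    points are needed: since [d{i,j} = 0], the distances from [i] are determined
    by the distances from [j]. *)
Lemma not_adjacent_triangle T i j : (3 < n)%N -> #|T| = 3 ->
  i \in T -> j \in T -> i != j ->
  ~ adjacent (SMET n 1 (1 : R)) (ST 1 1 T i) (ST 1 1 T j).
Proof.
move=> n_gt3 cT iT jT ij.
have card_pair l : l != i -> #|[set i; l]| = 2 by rewrite cards2 eq_sym => ->.
apply: (@not_adjacent_elim _ _ _ _ ltr01 _ _ _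
  [set [set i; l] | l in ~: [set i]] (fun P => j |: P :\ i)).
(* For the pair {i, j}, the set [j |: P :\ i] is the singleton of j, so that the
   equation for this pair is d{i,j} = 0. *)
- by rewrite ltr1n.
- rewrite card_in_imset => [|k l]; last first.
    rewrite !inE => ki li /setP/(_ k).
    by rewrite !inE eqxx orbT (negPf ki) => /esym/eqP.
  by have := cardsC1 i; rewrite card_ord; lia.
- move=> P /imsetP[l]; rewrite !inE => li ->; split; first exact: card_pair.
  apply/imsetP => -[k _ /setP/(_ i)].
  by rewrite !inE eqxx (negPf ij).
move=> d di dj P /imsetP[l]; rewrite !inE => li ->.
have [Sd _] := di.
have -> : j |: [set i; l] :\ i = [set j; l].
  by rewrite setU1K// inE eq_sym.
have jTi : j \in T :\ i by rewrite !inE eq_sym ij.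
have [k Uk] : exists k, T :\ i :\ j = [set k].
  by apply/cards1P; rewrite (card_setD1S (card_setD1S cT iT) jTi).
have [_ /(_ k)] := ST_ST_facets cT iT jT ij di dj.
have /and3P[kj ki kT] : [&& k != j, k != i & k \in T].
  by have := set11 k; rewrite -Uk !inE.
have -> : T :\ k = [set i; j].
  rewrite -(setD1K iT) -(setD1K jTi) Uk.
  have -> : i |: (j |: [set k]) = k |: [set i; j].
    by apply/setP => w; rewrite !inE; do 3!case: (w == _).
  by rewrite setU1K// !inE negb_or ki.
rewrite Uk set11 => /(_ isT) dij.
have [->|lj] := eqVneq l j.
  by rewrite dij dval_out// setUid cards1.
have cV : #|l |: [set i; j]| = 3.
  by rewrite cardsU1 !inE negb_or li lj cards2 ij.
have <- : (l |: [set i; j]) :\ j = [set i; l].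
  have -> : l |: [set i; j] = j |: [set i; l].
    by apply/setP => w; rewrite !inE; do 3!case: (w == _).
  by rewrite setU1K// !inE negb_or !(eq_sym j) ij.
have <- : (l |: [set i; j]) :\ i = [set j; l].
  have -> : l |: [set i; j] = i |: [set j; l].
    by apply/setP => w; rewrite !inE; do 3!case: (w == _).
  by rewrite setU1K// !inE negb_or ij eq_sym.
symmetry; apply: (semimetric_eq (l := l) Sd cV); rewrite ?inE ?eqxx ?orbT//.
by rewrite setU1K// !inE negb_or li.
Qed.

End Hemimetrics.

Theorem theorem1 (R : realType) (m n : nat) (s : R)
    (hm : (1 <= m)%N) (hn : (1 <= n)%N) (hs0 : 0 < s) (hs1 : s < (m.+1)%:R) :
  [/\ (* (i) *)
      forall (A : {set 'I_n}) (i : 'I_n), #|A| = m.+2 -> i \in A ->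
        is_facet (SMET n m s) (NN m s (A :\ i)) ->
        is_facet (SMET n m s) (ST m s A i) ->
        ~ adjacent (SMET n m s) (NN m s (A :\ i)) (ST m s A i),
      (* (ii); for (m, n) = (1, 3) the claim is false *)
      s = 1 -> ~ (m = 1%N /\ n = 3%N) ->
      forall (T : {set 'I_n}) (i j : 'I_n), #|T| = m.+2 ->
        i \in T -> j \in T -> i <> j ->
        is_facet (SMET n m s) (ST m s T i) ->
        is_facet (SMET n m s) (ST m s T j) ->
        ~ adjacent (SMET n m s) (ST m s T i) (ST m s T j)
    & (* (iii) *)
      (m%:R - 1 <= s < m%:R) ->
      forall A B : {set 'I_n}, #|A| = m.+1 -> #|B| = m.+1 ->
        #|A :&: B| = m ->
        is_facet (SMET n m s) (NN m s A) ->
        is_facet (SMET n m s) (NN m s B) ->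
        ~ adjacent (SMET n m s) (NN m s A) (NN m s B)].
Proof.
split=> [A i cA iA _ _|s1 not13 T i j cT iT jT /eqP ij _ _
  |/andP[s_ge _] A B cA cB cAB _ _].
- exact: not_adjacent_NN_ST.
- have [m1|m_gt1] : m = 1%N \/ (1 < m)%N by lia.
    (* T has 3 points and n <> 3, so there is a fourth point. *)
    subst m s; apply: not_adjacent_triangle => //.
    have : (#|T| <= n)%N by rewrite -[X in (_ <= X)%N]card_ord max_card.
    lia.
  by rewrite s1; apply: not_adjacent_ST_ST.
have /eqP/cards1P[b Db] : #|A :\: B| = 1%N by rewrite cardsD cA cAB; lia.
have /eqP/cards1P[a Da] : #|B :\: A| = 1%N by rewrite cardsD setIC cB cAB; lia.
have /setDP[bA bB] : b \in A :\: B by rewrite Db set11.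
have /setDP[aB aA] : a \in B :\: A by rewrite Da set11.
have UA : A :|: B = a |: A.
  rewrite -Da; apply/setP => w; rewrite !inE.
  by case: (w \in A); case: (w \in B).
have UB : A :|: B = b |: B.
  rewrite -Db; apply/setP => w; rewrite !inE.
  by case: (w \in A); case: (w \in B).
(* With T = A :|: B, the two sets are the facets T :\ a and T :\ b of T. *)
rewrite -{1}(setU1K aA) -{1}(setU1K bB) -UA -UB.
apply: not_adjacent_NN_NN => //; rewrite ?inE ?aB ?bA ?orbT//.
  by rewrite UA cardsU1 aA cA.
by apply: contraNneq aA => ->.
Qed.
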